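(* For any odd positive integer $k$, \[\{G\mid c_2(G)\leq k\}=\{G\mid \mathrm{mr}(G,\mathbb{F}_2)\leq k\},\] where $G$ ranges over all finite simple graphs.
   Context: All graphs are finite and simple. A subgraph complementation system for a graph $G=(V,E)$ is a finite collection (family) $\mathscr{C}$ of subsets of $V$ such that, for any two distinct vertices $u,v\in V$, $uv\in E$ if and only if $u$ and $v$ appear together in an odd number of sets in $\mathscr{C}$. The subgraph complementation number $c_2(G)$ is the minimum cardinality of a subgraph complementation system for $G$. A symmetric matrix over a field $\mathbb{F}$ with rows and columns indexed by $V$ fits $G$ if, for distinct $u,v$, its $(u,v)$ entry is nonzero if and only if $uv\in E$ (the diagonal is arbitrary). $\mathrm{mr}(G,\mathbb{F})$ is the minimum rank over $\mathbb{F}$ of a symmetric matrix over $\mathbb{F}$ which fits $G$. *)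

(* Defs.v *)
From mathcomp Require Import all_boot all_order all_algebra.
From mathcomp Require Import boolp.

Set Implicit Arguments.
Unset Strict Implicit.
Unset Printing Implicit Defensive.

Import GRing.Theory.
Local Open Scope ring_scope.

Record sgraph := SGraph {
  vertex :> finType;
  adj : rel vertex;
  adj_sym : symmetric adj;
  adj_irrefl : irreflexive adj }.

(* A family of vertex sets is a sequence, so repeated members count with
   multiplicity, both in the parity condition and in the cardinality. *)
Definition subgraph_complementation_system (G : sgraph) (C : seq {set G}) : Prop :=
  forall u v : G, u != v ->
    (adj u v <-> odd (count (fun S : {set G} => (u \in S) && (v \in S)) C)).

(* The edges themselves, as two-element sets, form a system. *)
Lemma subgraph_complementation_system_ex (G : sgraph) :
  exists n : nat,
    `[< exists C : seq {set G},
          subgraph_complementation_system C /\ size C = n >].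
Proof.
pose E := [set S : {set G} | [exists x, exists y, adj x y && (S == [set x; y])]].
exists (size (enum E)); apply/asboolP; exists (enum E); split=> // u v neq_uv.
have memE (S : {set G}) : S \in enum E -> u \in S -> v \in S ->
    (S == [set u; v]) && adj u v.
  rewrite mem_enum inE => /existsP[x /existsP[y /andP[xy /eqP->]]].
  rewrite !inE => /orP[/eqP eu|/eqP eu] /orP[/eqP ev|/eqP ev]; subst x || subst y;
    subst; rewrite ?eqxx // in neq_uv *.
  by rewrite setUC eqxx adj_sym.
have [uv|nuv] := boolP (adj u v); split=> //.
  move=> _; rewrite (eq_in_count (a2 := pred1 [set u; v])).
    rewrite count_uniq_mem ?enum_uniq // mem_enum inE.
    suff -> : [exists x, exists y, adj x y && ([set u; v] == [set x; y])] by [].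
    by apply/existsP; exists u; apply/existsP; exists v; rewrite uv eqxx.
  move=> S SE /=; apply/andP/eqP => [[uS vS]|->].
    by have /andP[/eqP] := memE S SE uS vS.
  by rewrite !inE !eqxx orbT.
rewrite (eq_in_count (a2 := pred0)) ?count_pred0 // => S SE /=.
by apply/negP => /andP[uS vS]; have /andP[_] := memE S SE uS vS; apply/negP.
Qed.

Definition c2 (G : sgraph) : nat := ex_minn (subgraph_complementation_system_ex G).

(* Rows and columns are indexed by the vertices through [enum_val]. *)
Definition fits (G : sgraph) (F : fieldType) (A : 'M[F]_#|G|) : Prop :=
  A^T = A /\
  forall i j : 'I_#|G|, i != j ->
    (A i j != 0 <-> adj (enum_val i : G) (enum_val j)).

(* The adjacency matrix fits. *)
Lemma fits_ex (G : sgraph) (F : fieldType) :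
  exists r : nat, `[< exists A : 'M[F]_#|G|, fits A /\ \rank A = r >].
Proof.
pose A : 'M[F]_#|G| :=
  \matrix_(i, j) (adj (enum_val i : G) (enum_val j))%:R.
exists (\rank A); apply/asboolP; exists A; split=> //; split.
  by apply/matrixP => i j; rewrite !mxE adj_sym.
by move=> i j _; rewrite mxE; case: adj; rewrite ?oner_eq0 ?eqxx.
Qed.

Definition mr (G : sgraph) (F : fieldType) : nat := ex_minn (fits_ex G F).

(* Main.v *)
Require Import Defs.
From mathcomp Require Import all_boot all_order all_algebra.
From mathcomp Require Import boolp zify.

(** The incidence matrix [M] of a system of [m] sets has [M *m M^T] fitting [G],
so the question is how many columns are needed to write a symmetric matrix [A]
over [F_2] as [M *m M^T].  If [A i i = 1], subtracting the square of column [i]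
lowers the rank by one.  If [A] has zero diagonal and [A i j = 1], subtracting
[u v^T + v u^T], with [u] and [v] the columns [i] and [j], lowers the rank by two.
In characteristic 2,
[w w^T + u v^T + v u^T = (w+u)(w+u)^T + (w+v)(w+v)^T + (w+u+v)(w+u+v)^T],
so a square absorbs each such pair at the cost of two more squares.  Hence
[rank A] columns suffice when the diagonal is nonzero, and otherwise one more
than an even number bounded by [rank A], which is at most [k] when [k] is odd. *)

Set Implicit Arguments.
Unset Strict Implicit.
Unset Printing Implicit Defensive.

Import GRing.Theory.
Local Open Scope ring_scope.

(** By rank-nullity, [\rank A] is the rank of [A *m Q] plus the dimension of the part of the row
    space of [A] killed by [Q]. The first is at least [p] because [P] maps [A *m Q] to the identity;
    the second contains the rows of [B]. *)
Lemma rank_add_leq (F : fieldType) (m n p : nat) (A : 'M[F]_(m, n))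
    (B : 'M_(m, n)) (P : 'M_(p, m)) (Q : 'M_(n, p)) :
  (B <= A)%MS -> B *m Q = 0 -> P *m A *m Q = 1%:M ->
  (\rank B + p <= \rank A)%N.
Proof.
move=> leBA BQ0 PAQ1; rewrite -(mxrank_mul_ker A Q) addnC leq_add //.
  rewrite -[X in (X <= _)%N](@mxrank1 F p) -PAQ1 -mulmxA.
  exact: mxrankM_maxr.
by apply: mxrankS; rewrite sub_capmx leBA; apply/sub_kermxP.
Qed.

Lemma F2P (x : 'F_2) : x = 0 \/ x = 1.
Proof. by case: x => [[|[|]]] // lt2; [left|right]; apply: val_inj. Qed.

Lemma F2_neq0 (x : 'F_2) : (x != 0) = (x == 1).
Proof. by case: (F2P x) => ->. Qed.

Lemma F2_natr_neq0 (n : nat) : ((n%:R : 'F_2) != 0) = odd n.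
Proof. by rewrite -(dvdn_pcharf (pchar_Fp (p := 2) isT)) dvdn2 negbK. Qed.

Section Gram.
Variable n : nat.
Implicit Types A : 'M['F_2]_n.

Definition gram A (m : nat) := exists M : 'M['F_2]_(n, m), A = M *m M^T.

Lemma gram_add A B a b : gram A a -> gram B b -> gram (A + B) (a + b).
Proof. by move=> [M ->] [N ->]; exists (row_mx M N); rewrite tr_row_mx mul_row_col. Qed.

Lemma gram_square (w : 'cV_n) : gram (w *m w^T) 1.
Proof. by exists w. Qed.

Lemma square_add_hyperbolic (w u v : 'cV['F_2]_n) :
  w *m w^T + (u *m v^T + v *m u^T) =
  (w + u) *m (w + u)^T + (w + v) *m (w + v)^T + (w + u + v) *m (w + u + v)^T.
Proof.
apply/matrixP => a b; rewrite !mxE !big_ord1 !mxE.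
by case: (F2P (w a 0)) => ->; case: (F2P (w b 0)) => ->;
   case: (F2P (u a 0)) => ->; case: (F2P (u b 0)) => ->;
   case: (F2P (v a 0)) => ->; case: (F2P (v b 0)) => ->; apply: val_inj.
Qed.

(** Symmetry makes [u^T] row [i] of [A], so the difference is a left multiple of [A]; it kills the
    [i]-th unit vector, while [A i i = 1]. *)
Lemma rank_sub_square A i (u := col i A) : A^T = A -> A i i = 1 ->
  (\rank (A - u *m u^T)%R < \rank A)%N.
Proof.
move=> symA Aii.
have uT : u^T = delta_mx 0 i *m A by rewrite /u tr_col symA rowE.
rewrite -addn1.
apply: (rank_add_leq (P := delta_mx 0 i) (Q := delta_mx i 0)).
- by rewrite uT mulmxA -{1}[A]mul1mx -mulmxBl submxMl.
- rewrite mulmxBl -mulmxA uT -!mulmxA -!colE.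
  rewrite -rowE (_ : row i _ = 1%:M) ?mulmx1 ?subrr //.
  by apply/matrixP => a b; rewrite !ord1 !mxE Aii.
- rewrite -mulmxA -colE -rowE.
  by apply/matrixP => a b; rewrite !ord1 !mxE Aii.
Qed.

Lemma rank_sub_hyperbolic A i j (u := col i A) (v := col j A) : A^T = A ->
  A i i = 0 -> A j j = 0 -> A i j = 1 ->
  (\rank (A - (u *m v^T + v *m u^T))%R + 2 <= \rank A)%N.
Proof.
move=> symA Aii Ajj Aij.
have Aji : A j i = 1 by rewrite -symA mxE.
have uT : u^T = delta_mx 0 i *m A by rewrite /u tr_col symA rowE.
have vT : v^T = delta_mx 0 j *m A by rewrite /v tr_col symA rowE.
have entry a b : delta_mx (0 : 'I_1) a *m (A *m delta_mx b (0 : 'I_1)) = (A a b)%:M.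
  by rewrite -colE -rowE; apply/matrixP => c d; rewrite !ord1 !mxE.
(* The principal block on [i], [j] is the swap matrix, so [P] lists the unit rows in reverse order
   to turn it into the identity. *)
apply: (rank_add_leq (p := 1 + 1) (P := col_mx (delta_mx 0 j) (delta_mx 0 i))
  (Q := row_mx (delta_mx i 0) (delta_mx j 0))).
- by rewrite uT vT !mulmxA -mulmxDl -{1}[A]mul1mx -mulmxBl submxMl.
- rewrite mul_mx_row !mulmxBl !mulmxDl -!mulmxA uT vT -!mulmxA !entry.
  rewrite Aii Ajj Aij Aji raddf0 !mulmx0 !mulmx1 -!colE add0r addr0 !subrr.
  exact: row_mx0.
- rewrite -mulmxA mul_mx_row mul_col_row !entry Aii Ajj Aij Aji raddf0.
  by rewrite -scalar_mx_block.
Qed.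

(** The vector [w] is arbitrary because it changes along the induction on the rank; it may also be
    zero. *)
Lemma gram_square_add_alternating A (w : 'cV_n) :
  A^T = A -> (forall i, A i i = 0) ->
  exists2 m, (m.*2 <= \rank A)%N & gram (w *m w^T + A) m.*2.+1.
Proof.
have [r] := ubnP (\rank A); elim: r A w => // r IHr A w ltAr symA diagA.
case: (pickP (fun p : 'I_n * 'I_n => A p.1 p.2 != 0)) => [[i j] /= Aij0|A0]; last first.
  exists 0%N => //; rewrite [A](_ : _ = 0) ?addr0; first exact: gram_square.
  by apply/matrixP => i j; rewrite mxE; apply/eqP/negbFE/(A0 (i, j)).
have Aij : A i j = 1 by apply/eqP; rewrite -F2_neq0.
set u := col i A; set v := col j A; set H := u *m v^T + v *m u^T.
have symH : H^T = H by rewrite linearD /= !trmx_mul !trmxK addrC.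
have ltB : (\rank (A - H)%R + 2 <= \rank A)%N by exact: rank_sub_hyperbolic.
(* Of the three squares replacing [w *m w^T + H], the last takes over the role of [w]; the other two
   account for the step from [m] to [m.+1]. *)
have [|||m lem gm] := IHr (A - H) (w + u + v); first by lia.
- by rewrite linearB /= symA symH.
(* Diagonal entries of [H] have the form [2 u_l v_l = 0], so the remainder stays alternating. *)
- move=> l; rewrite !mxE !big_ord1 !mxE diagA.
  by case: (F2P (A l i)) => ->; case: (F2P (A l j)) => ->; apply: val_inj.
exists m.+1; first by lia.
rewrite -[A](subrK H) [_ - H + H]addrC addrA square_add_hyperbolic.
rewrite -(addrA _ _ (A - H)) -(addrA _ (_ *m _) (_ + (A - H))).
rewrite (_ : m.+1.*2.+1 = 1 + (1 + m.*2.+1))%N; last by lia.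
by do 2![apply: gram_add; first exact: gram_square].
Qed.

(** Squares of columns are peeled off while the remainder has a nonzero diagonal entry. Once it is
    alternating, the last square peeled off serves as the absorbing one, and the rank drop it caused
    pays for it. *)
Lemma gram_nonalternating A i : A^T = A -> A i i = 1 ->
  exists2 m, (m <= \rank A)%N & gram A m.
Proof.
have [r] := ubnP (\rank A); elim: r A i => // r IHr A i ltAr symA Aii.
set w := col i A; set B := A - w *m w^T.
have symB : B^T = B by rewrite linearB /= symA trmx_mul trmxK.
have ltB : (\rank B < \rank A)%N by exact: rank_sub_square.
have defA : A = w *m w^T + B by rewrite addrC subrK.
have [j Bjj0|B0] := pickP (fun j => B j j != 0); last first.
  have [//||m lem gm] := @gram_square_add_alternating B w.
    by move=> j; apply/eqP/negbFE/B0.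
  by exists m.*2.+1; [lia | rewrite defA].
have [|//||m lem gm] := IHr B j; first by lia.
  by apply/eqP; rewrite -F2_neq0.
by exists (1 + m)%N; [lia | rewrite defA; apply: gram_add => //; apply: gram_square].
Qed.

Lemma gram_odd_bound A k : A^T = A -> odd k -> (\rank A <= k)%N ->
  exists2 m, (m <= k)%N & gram A m.
Proof.
move=> symA oddk leAk.
have [i Aii0|A0] := pickP (fun i => A i i != 0); last first.
  (* The zero vector supplies the absorbing square. Then [m.*2 <= k] with [k] odd leaves room for
     the extra column. *)
  have [//||m lem gm] := @gram_square_add_alternating A 0.
    by move=> i; apply/eqP/negbFE/A0.
  by rewrite mul0mx add0r in gm; exists m.*2.+1 => //; lia.
have [//||m lem gm] := @gram_nonalternating A i.
  by apply/eqP; rewrite -F2_neq0.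
by exists m => //; apply: leq_trans leAk.
Qed.

Lemma rank_gram A m : gram A m -> (\rank A <= m)%N.
Proof. by case=> M ->; apply: leq_trans (mxrankM_maxl _ _) (rank_leq_col _). Qed.

End Gram.

Section Incidence.
Variable G : sgraph.

Lemma c2_leP k : reflect
  (exists2 C : seq {set G}, subgraph_complementation_system C & (size C <= k)%N)
  (c2 G <= k)%N.
Proof.
apply: (iffP idP); rewrite /c2; case: ex_minnP => m /asboolP[C [sysC <-]] minm.
  by exists C.
case=> D sysD.
by apply: leq_trans; apply: minm; apply/asboolP; exists D.
Qed.

Lemma mr_leP (F : fieldType) k : reflect
  (exists2 A : 'M[F]_#|G|, fits A & (\rank A <= k)%N) (mr G F <= k)%N.
Proof.
apply: (iffP idP); rewrite /mr; case: ex_minnP => m /asboolP[A [fitA <-]] minm.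
  by exists A.
case=> B fitB.
by apply: leq_trans; apply: minm; apply/asboolP; exists B.
Qed.

(** Modulo 2, an entry of [M *m M^T] counts the sets containing both vertices. *)
Lemma gram_of_system (C : seq {set G}) : subgraph_complementation_system C ->
  exists2 A : 'M['F_2]_#|G|, fits A & gram A (size C).
Proof.
move=> sysC.
pose M : 'M['F_2]_(#|G|, size C) := \matrix_(i, c) (enum_val i \in nth set0 C c)%:R.
exists (M *m M^T); last by exists M.
split=> [|i j neq_ij]; first by rewrite trmx_mul trmxK.
rewrite mxE sysC ?(inj_eq enum_val_inj) // -F2_natr_neq0.
rewrite (_ : \sum_c _ = (count (fun S : {set G} =>
  (enum_val i \in S) && (enum_val j \in S)) C)%:R) //.
rewrite -sum1_count natr_sum (big_nth set0) big_mkord [RHS]big_mkcond /=.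
by apply: eq_bigr => c _; rewrite !mxE -natrM mulnb; case: ifP.
Qed.

(** The supports of the columns form the system. Equal columns give repeated members of the
    sequence, so no column is lost in the size. *)
Lemma system_of_gram (A : 'M['F_2]_#|G|) m : fits A -> gram A m ->
  exists2 C : seq {set G}, subgraph_complementation_system C & size C = m.
Proof.
move=> [_ fitA] [M defA].
pose S (c : 'I_m) := [set v : G | M (enum_rank v) c != 0].
exists [seq S c | c : 'I_m]; last by rewrite size_map -cardT card_ord.
move=> u v neq_uv.
rewrite -{1}[u]enum_rankK -{1}[v]enum_rankK -fitA; last first.
  by rewrite (inj_eq enum_rank_inj).
rewrite -F2_natr_neq0 (_ : _%:R = A (enum_rank u) (enum_rank v)) //.
rewrite defA mxE count_map -sum1_count natr_sum big_enum_cond [LHS]big_mkcond /=.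
apply: eq_bigr => c _; rewrite !inE mxE.
by case: (F2P (M (enum_rank u) c)) => ->;
   case: (F2P (M (enum_rank v) c)) => ->; apply: val_inj.
Qed.

End Incidence.

Theorem proposition5p1 (k : nat) (hk : odd k) (G : sgraph) :
  (c2 G <= k)%N <-> (mr G 'F_2 <= k)%N.
Proof.
split=> [/c2_leP[C sysC leCk]|/mr_leP[A fitA leAk]].
  have [A fitA /rank_gram leAC] := gram_of_system sysC.
  by apply/mr_leP; exists A => //; apply: leq_trans leCk.
have [m lemk gramA] := gram_odd_bound fitA.1 hk leAk.
have [C sysC sizeC] := system_of_gram fitA gramA.
by apply/c2_leP; exists C; rewrite ?sizeC.
Qed.
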